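(* Let $\mathfrak g$ be a $6$-dimensional $2$-step nilpotent Lie algebra endowed with an abelian complex structure $J$ given by a basis $\{\omega^1,\omega^2,\omega^3\}$ of $(1,0)$-forms satisfying $$d\omega^1=d\omega^2=0,\qquad d\omega^3=\omega^{1\bar1}+\delta\,\omega^{1\bar2}+(x+yi)\,\omega^{2\bar2},$$ where $\delta\in\{0,1\}$ and $x,y\in\mathbb R$. Suppose that $J$ admits a balanced $J$-Hermitian metric. Then $\mathfrak g$ is isomorphic to $\mathfrak h_3$ when $\delta=0$, or to $\mathfrak h_5$ when $\delta=1$.
   Context: A complex structure on a Lie algebra $\mathfrak g$ is an endomorphism $J$ with $J^2=-\mathrm{Id}$ and $[JX,JY]=J[JX,Y]+J[X,JY]+[X,Y]$; it is abelian if $[JX,JY]=[X,Y]$ for all $X,Y$. $J$ acts on $1$-forms by $(J\alpha)(X)=-\alpha(JX)$ and $(1,0)$-forms are the elements of $\mathfrak g^*_{\mathbb C}$ with eigenvalue $i$ for this action. $d$ is the Chevalley-Eilenberg differential extended complex-linearly, and $\omega^{j\bar k}=\omega^j\wedge\overline{\omega^k}$. A $J$-Hermitian metric is an inner product $g$ on $\mathfrak g$ with $g(\cdot,\cdot)=g(J\cdot,J\cdot)$; with $F(X,Y)=g(X,JY)$ it is balanced if $d(F\wedge F)=0$. $\mathfrak h_3$: dual basis with $de^1=\cdots=de^5=0$, $de^6=e^1\wedge e^2+e^3\wedge e^4$. $\mathfrak h_5$: dual basis with $de^1=\cdots=de^4=0$, $de^5=e^1\wedge e^3+e^4\wedge e^2$,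 $de^6=e^1\wedge e^4+e^2\wedge e^3$. *)

(* Defs.v *)
From HB Require Import structures.
From mathcomp Require Import all_boot all_order all_algebra all_fingroup.
From mathcomp Require Import sesquilinear.
From mathcomp Require Import reals.
From mathcomp Require Import complex.
From mathcomp Require Import ring.

Set Implicit Arguments.
Unset Strict Implicit.
Unset Printing Implicit Defensive.

Import Order.TTheory GRing.Theory Num.Theory.
Local Open Scope ring_scope.

HB.mixin Record isLieAlgebra (F : fieldType) V of Vector F V := {
  lie : V -> V -> V;
  lie_linear_l : forall y, linear (lie ^~ y);
  lie_linear_r : forall x, linear (lie x);
  liexx : forall x, lie x x = 0;
  lie_jacobi : forall x y z,
    lie x (lie y z) + lie y (lie z x) + lie z (lie x y) = 0
}.

#[short(type="lieAlgType")]
HB.structure Definition LieAlgebra (F : fieldType) :=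
  { V of isLieAlgebra F V & Vector F V }.

HB.instance Definition _ (F : fieldType) (g : lieAlgType F) :=
  bilinear_isBilinear.Build F g g g *:%R *:%R (@lie F g)
    (conj (@lie_linear_l F g) (@lie_linear_r F g)).

Definition lie_isomorphic (F : fieldType) (g h : lieAlgType F) : Prop :=
  exists f : {linear g -> h},
    bijective f /\ forall x y : g, f (lie x y) = lie (f x) (f y).

Section LowerCentralSeries.
Variables (F : fieldType) (g : lieAlgType F).

(* [U, W], the span of all brackets; basis vectors suffice by bilinearity *)
Definition lie_prodv (U W : {vspace g}) : {vspace g} :=
  <<[seq lie u w | u <- vbasis U, w <- vbasis W]>>%VS.

Definition lower_central (k : nat) : {vspace g} := iter k (lie_prodv fullv) fullv.

Definition step_nilpotent (k : nat) : Prop :=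
  lower_central k = 0%VS /\ forall j, (j < k)%N -> lower_central j <> 0%VS.

End LowerCentralSeries.

(* p-forms on V with values in K are represented by functions of p vectors.
   The operations below are only meaningful for alternating multilinear
   functions, with K of characteristic 0. *)
Section Forms.
Variables (V : Type) (K : fieldType).

Definition pform (p : nat) := ('I_p -> V) -> K.

Definition form1 (a : V -> K) : pform 1 := fun X => a (X ord0).

(* (a /\ b)(X_1, .., X_(p+q)) = 1/(p! q!) \sum_s sgn(s)
     a(X_s(1), .., X_s(p)) b(X_s(p+1), .., X_s(p+q)) *)
Definition wedge (p q : nat) (a : pform p) (b : pform q) : pform (p + q) :=
  fun X => (p`! * q`!)%:R^-1 *
    \sum_(s : 'S_(p + q)) (-1) ^+ s * a (fun i => X (s (lshift q i)))
                                    * b (fun j => X (s (rshift p j))).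

Definition vcons (p : nat) (x : V) (X : 'I_p -> V) : 'I_p.+1 -> V :=
  fun k => oapp X x (unlift ord0 k).

Lemma wedge11 (a b : V -> K) (X : 'I_2 -> V) :
  wedge (form1 a) (form1 b) X =
  a (X ord0) * b (X ord_max) - a (X ord_max) * b (X ord0).
Proof.
rewrite /wedge /form1 /= muln1 invr1 mul1r.
have l0 : lshift 1 (ord0 : 'I_1) = ord0 :> 'I_2 by apply/val_inj.
have r0 : rshift 1 (ord0 : 'I_1) = ord_max :> 'I_2 by apply/val_inj.
have tN1 : tperm ord0 ord_max != 1%g :> 'S_2.
  by apply/eqP => /permP /(_ ord0); rewrite tpermL perm1.
rewrite (bigD1 (1%g : 'S_2)) //= (bigD1 (tperm ord0 ord_max : 'S_2)) //= big1.
  rewrite odd_perm1 odd_tperm /= l0 r0 !perm1 tpermL tpermR.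
  by rewrite expr0 mul1r expr1 mulN1r mulNr addr0.
move=> s /andP[sN1 sNt]; exfalso.
have h (i : 'I_2) : i = ord0 \/ i = ord_max.
  by case: i => [[|[|]]] // ?; [left|right]; apply/val_inj.
have sne : s ord0 <> s ord_max by move/perm_inj.
case: (h (s ord0)) (h (s ord_max)) => [e0|e0] [e1|e1].
- by apply: sne; rewrite e0 e1.
- case/eqP: sN1; apply/permP => i; rewrite perm1.
  by case: (h i) => ->.
- case/eqP: sNt; apply/permP => i.
  by case: (h i) => ->; rewrite ?tpermL ?tpermR.
- by apply: sne; rewrite e0 e1.
Qed.

End Forms.

(* Chevalley-Eilenberg differential:
     (d a)(X_0, .., X_p) = \sum_(i < j) (-1)^(i + j)
       a([X_i, X_j], X_0, .., ^X_i, .., ^X_j, .., X_p).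
   For i < j, lift j i is the index i itself, and k |-> lift j (lift i k)
   enumerates in order the indices other than i and j. *)
Definition ce_diff (F K : fieldType) (g : lieAlgType F) (p : nat) :
    pform g K p -> pform g K p.+1 :=
  match p with
  | 0 => fun _ _ => 0
  | p'.+1 => fun a X =>
      \sum_(j < p'.+2) \sum_(i < p'.+1 | (i < j)%N) (-1) ^+ (i + j) *
        a (vcons (lie (X (lift j i)) (X j))
                 (fun k : 'I_p' => X (lift j (lift i k))))
  end.

Lemma ce_diff1 (F K : fieldType) (g : lieAlgType F) (a : g -> K)
    (X : 'I_2 -> g) :
  ce_diff (form1 a) X = - a (lie (X ord0) (X ord_max)).
Proof.
rewrite /ce_diff big_ord_recl big_pred0 // add0r.
rewrite big_ord1 (big_pred1 ord0) => [|i]; last by rewrite ord1.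
rewrite /form1 /vcons unlift_none /= expr1 mulN1r.
by congr (- a (lie (X _) (X _))); apply/val_inj.
Qed.

Section ComplexStructures.
Variables (R : realType) (g : lieAlgType R).

Definition complex_structure (J : {linear g -> g}) : Prop :=
  (forall X, J (J X) = - X) /\
  (forall X Y, lie (J X) (J Y) = J (lie (J X) Y) + J (lie X (J Y)) + lie X Y).

Definition abelian_complex_structure (J : {linear g -> g}) : Prop :=
  complex_structure J /\ forall X Y, lie (J X) (J Y) = lie X Y.

(* The complexified dual of g, as the R-linear maps from g to R[i] *)
Definition cdual := {linear g -> R[i] | real_complex R \; *%R}.

(* With (J a)(X) = - a(J X), the (1,0)-forms satisfy J a = i a. *)
Definition is_form10 (J : {linear g -> g}) (a : cdual) : Prop :=
  forall X, - a (J X) = 'i%C * a X.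

Definition form10_basis (n : nat) (J : {linear g -> g}) (w : 'I_n -> cdual) :
    Prop :=
  (forall k, is_form10 J (w k)) /\
  forall a : cdual, is_form10 J a ->
    exists! c : 'rV[R[i]]_n, forall X, a X = \sum_k c 0 k * w k X.

(* The 2-form w^(j \bar k) = w^j /\ \bar(w^k) *)
Definition wedge_bar (a b : cdual) : pform g R[i] 2 :=
  wedge (form1 a) (form1 (fun X => (b X)^*%C)).

Definition hermitian_metric (J : {linear g -> g}) (h : {dot g for idfun}) :
    Prop :=
  forall X Y, h X Y = h (J X) (J Y).

Definition fundamental_form (J : {linear g -> g}) (h : {dot g for idfun}) :
    pform g R 2 :=
  fun X => h (X ord0) (J (X ord_max)).

Definition balanced (J : {linear g -> g}) (h : {dot g for idfun}) : Prop :=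
  let F := fundamental_form J h in forall X, ce_diff (wedge F F) X = 0.

End ComplexStructures.

(* The Lie algebras h3 and h5 on F^6; e^(k+1) is the coordinate x |-> x 0 k,
   and the signs come from (d e)(x, y) = - e([x, y]). *)
Section H3H5.
Variable F : fieldType.

Definition h3 : Type := 'rV[F]_6.
HB.instance Definition _ := Vector.on h3.

Definition h5 : Type := 'rV[F]_6.
HB.instance Definition _ := Vector.on h5.

Definition coord2 (i j : 'I_6) (x y : 'rV[F]_6) : F :=
  x 0 i * y 0 j - x 0 j * y 0 i.

Definition h3_lie (x y : h3) : h3 :=
  \row_(k < 6) (- (if k == 5 then coord2 0 1 x y + coord2 2 3 x y else 0)).

Definition h5_lie (x y : h5) : h5 :=
  \row_(k < 6) (- (if k == 4 then coord2 0 2 x y + coord2 3 1 x y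
                   else if k == 5 then coord2 0 3 x y + coord2 1 2 x y
                   else 0)).

Fact h3_linear_l y : linear (h3_lie ^~ y).
Proof.
move=> a u v; apply/rowP => k; rewrite !mxE.
by case: ifP => _; rewrite /coord2 ?mxE; ring.
Qed.

Fact h3_linear_r x : linear (h3_lie x).
Proof.
move=> a u v; apply/rowP => k; rewrite !mxE.
by case: ifP => _; rewrite /coord2 ?mxE; ring.
Qed.

Fact h3_liexx x : h3_lie x x = 0.
Proof.
by apply/rowP => k; rewrite !mxE; case: ifP => _; rewrite /coord2; ring.
Qed.

Fact h3_jacobi x y z :
  h3_lie x (h3_lie y z) + h3_lie y (h3_lie z x) + h3_lie z (h3_lie x y) = 0.
Proof.
apply/rowP => k; rewrite !mxE.
by case: ifP => _; rewrite /coord2 ?mxE /=; ring.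
Qed.

HB.instance Definition _ := isLieAlgebra.Build F h3
  h3_linear_l h3_linear_r h3_liexx h3_jacobi.

Fact h5_linear_l y : linear (h5_lie ^~ y).
Proof.
move=> a u v; apply/rowP => k; rewrite !mxE.
by do 2?[case: ifP => _]; rewrite /coord2 ?mxE; ring.
Qed.

Fact h5_linear_r x : linear (h5_lie x).
Proof.
move=> a u v; apply/rowP => k; rewrite !mxE.
by do 2?[case: ifP => _]; rewrite /coord2 ?mxE; ring.
Qed.

Fact h5_liexx x : h5_lie x x = 0.
Proof.
apply/rowP => k; rewrite !mxE.
by do 2?[case: ifP => _]; rewrite /coord2; ring.
Qed.

Fact h5_jacobi x y z :
  h5_lie x (h5_lie y z) + h5_lie y (h5_lie z x) + h5_lie z (h5_lie x y) = 0.
Proof.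
apply/rowP => k; rewrite !mxE.
by do 2?[case: ifP => _]; rewrite /coord2 ?mxE /=; ring.
Qed.

HB.instance Definition _ := isLieAlgebra.Build F h5
  h5_linear_l h5_linear_r h5_liexx h5_jacobi.

Definition h3_dual (k : 'I_6) : pform h3 F 1 :=
  form1 (fun x : h3 => (x : 'rV_6) 0 k).
Definition h5_dual (k : 'I_6) : pform h5 F 1 :=
  form1 (fun x : h5 => (x : 'rV_6) 0 k).

Lemma h3_structure_equations (X : 'I_2 -> h3) :
  (forall k : 'I_6, (k < 5)%N -> ce_diff (h3_dual k) X = 0) /\
  ce_diff (h3_dual 5) X =
    wedge (h3_dual 0) (h3_dual 1) X + wedge (h3_dual 2) (h3_dual 3) X.
Proof.
split=> [k k5|]; rewrite !ce_diff1 !mxE ?wedge11 /coord2 /=; last by ring.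
by case: ifP k5 => [/eqP ->|_ _]; rewrite ?opprK.
Qed.

Lemma h5_structure_equations (X : 'I_2 -> h5) :
  [/\ forall k : 'I_6, (k < 4)%N -> ce_diff (h5_dual k) X = 0,
      ce_diff (h5_dual 4) X =
        wedge (h5_dual 0) (h5_dual 2) X + wedge (h5_dual 3) (h5_dual 1) X &
      ce_diff (h5_dual 5) X =
        wedge (h5_dual 0) (h5_dual 3) X + wedge (h5_dual 1) (h5_dual 2) X].
Proof.
split=> [k k5||]; rewrite !ce_diff1 !mxE ?wedge11 /coord2 /=; [|by ring..].
by case: ifP k5 => [/eqP ->|_] //; case: ifP => [/eqP ->|_ _]; rewrite ?opprK.
Qed.

End H3H5.

(* Main.v *)
Require Import Defs.
From HB Require Import structures.
From mathcomp Require Import all_boot all_order all_algebra all_fingroup.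
From mathcomp Require Import sesquilinear reals complex.
From mathcomp Require Import ring lra.

(** Write D = x + iy.  The structure equations make the common kernel V of
    w1 and w2 a J-invariant plane that contains every bracket.

    Let h be a balanced J-Hermitian metric with fundamental form F, and choose
    A, B orthogonal to V with A orthogonal to B and JB.  On
    (Z, A, JA, B, JB) with Z in V, all but two of the ten terms of d(F /\ F)
    vanish by orthogonality, so that |B|^2 [A, JA] + |A|^2 [B, JB], which lies
    in V, is orthogonal to V: it is zero ([balanced_trace]).  Applying w3,
    with A and B normalised by w1 A = 1, w1 B = 0, w2 B = 1, this becomes
      1 + delta conj(c) + D (|c|^2 + rho) = 0,  rho > 0,
    that is, the trace of d w3 against the metric vanishes.

    For delta = 0 this forces D to be a nonzero real number
    ([trace_condition0]); then d w3 is purely imaginary, and rescaling the real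
    and imaginary parts of the w's gives the coframe of h3
    ([lie_isomorphic_h3]).

    For delta = 1 it forces 4x + 4y^2 < 1 ([trace_condition1]).  Then
    the pencil of 2-forms spanned by d w3 and its conjugate has a decomposable
    member eta1 /\ eta2 for which eta1, eta2 and their conjugates
    are linearly independent ([pencil_root]).  As h5 is the complex Heisenberg
    algebra regarded over the reals, whose complex coframe satisfies
    d eta3 = eta1 /\ eta2, this gives the isomorphism with h5
    ([lie_isomorphic_h5]). *)

Import Order.TTheory GRing.Theory Num.Theory.

Set Implicit Arguments.
Unset Strict Implicit.
Unset Printing Implicit Defensive.

Local Open Scope ring_scope.

(** * The square of a 2-form and its differential *)

Lemma sum_perm_ord0 (M : nmodType) (G : 'S_0 -> M) : \sum_s G s = G 1%g.
Proof.
rewrite (bigD1 1%g) //= big1 ?addr0 // => s /eqP[]; apply/permP => -[].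
by [].
Qed.

(** Classifying the permutations s by the value s 0 reduces a sum over the
    symmetric group to sums over the symmetric group on one letter fewer;
    iterating this makes a sum over a small symmetric group explicit. *)
Lemma sum_perm_ordS (M : nmodType) n (G : 'S_n.+1 -> M) :
  \sum_s G s = \sum_(j < n.+1) \sum_(s : 'S_n) G (lift_perm ord0 j s).
Proof.
rewrite (partition_big (fun s : 'S_n.+1 => s ord0) predT) //=.
apply: eq_bigr => j _.
pose restr (s : 'S_n.+1) k :=
  odflt k (unlift (s ord0) (s (lift ord0 k))).
have restrK (s : 'S_n.+1) k : lift (s ord0) (restr s k) = s (lift ord0 k).
  rewrite /restr; case: (unliftP (s ord0) (s (lift ord0 k))) => [k' -> //|].
  by move/perm_inj/eqP; rewrite eq_sym (negPf (neq_lift _ _)).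
have restr_inj s : injective (restr s).
  by move=> k l /(congr1 (lift (s ord0))); rewrite !restrK => /perm_inj/lift_inj.
rewrite (reindex (lift_perm ord0 j)); last first.
  exists (fun s => perm (@restr_inj s)) => s; rewrite inE => sj.
    apply/permP => k; rewrite permE; apply: (@lift_inj _ j).
    rewrite -(lift_perm_lift ord0) -(restrK (lift_perm ord0 j s)).
    by rewrite lift_perm_id.
  apply/permP => k; case: (unliftP ord0 k) => [k' ->|->].
    by rewrite lift_perm_lift permE -(eqP sj) restrK.
  by rewrite lift_perm_id (eqP sj).
by apply: eq_bigl => s; rewrite lift_perm_id eqxx.
Qed.

Definition form2 (V : Type) (K : fieldType) (a : V -> V -> K) : pform V K 2 :=
  fun X => a (X ord0) (X ord_max).

(** The 24 terms of the wedge product fall into three groups of eight equal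
    ones, one for each splitting of the four arguments into two pairs. *)
Lemma wedge_sqr (V : Type) (K : numFieldType) (a : V -> V -> K)
    (X : 'I_4 -> V) :
  (forall u v, a u v = - a v u) ->
  wedge (form2 a) (form2 a) X =
  2 * (a (X 0) (X 1) * a (X 2) (X 3) - a (X 0) (X 2) * a (X 1) (X 3)
       + a (X 0) (X 3) * a (X 1) (X 2)).
Proof.
move=> skew; rewrite /wedge /form2.
have e0 : @lshift 2 2 ord0 = ord0 by apply/val_inj.
have e1 : @lshift 2 2 ord_max = lift ord0 ord0 by apply/val_inj.
have e2 : @rshift 2 2 ord0 = lift ord0 (lift ord0 ord0) by apply/val_inj.
have e3 : @rshift 2 2 ord_max = lift ord0 (lift ord0 (lift ord0 ord0)).
  by apply/val_inj.
(* Read X through natural numbers, so that indices reduce by computation. *)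
have XE i : X i = X (inord i) by rewrite inord_val.
pose f n := X (inord n); have {}XE i : X i = f i by [].
under eq_bigr do rewrite e0 e1 e2 e3 !XE.
rewrite !XE -[nat_of_ord 0]/0%N -[nat_of_ord 1]/1%N.
rewrite -[nat_of_ord 2]/2%N -[nat_of_ord 3]/3%N.
move: f {XE} => f.
do 4! rewrite !sum_perm_ordS !big_ord_recl !big_ord0.
rewrite !sum_perm_ord0 !(lift_perm_lift, lift_perm_id).
rewrite !odd_lift_perm !odd_perm1 /=.
rewrite /bump /= !(addn0, addnS, addn1, add0n).
rewrite (skew (f 1%N) (f 0%N)) (skew (f 2%N) (f 0%N)) (skew (f 3%N) (f 0%N)).
rewrite (skew (f 2%N) (f 1%N)) (skew (f 3%N) (f 1%N)) (skew (f 3%N) (f 2%N)).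
have -> : (2`! * 2`!)%:R = 4 :> K by [].
by field.
Qed.

Lemma vcons0 (V : Type) p (x : V) (X : 'I_p -> V) : vcons x X ord0 = x.
Proof. by rewrite /vcons unlift_none. Qed.

Lemma vconsS (V : Type) p (x : V) (X : 'I_p -> V) k :
  vcons x X (lift ord0 k) = X k.
Proof. by rewrite /vcons liftK. Qed.

Lemma ce_diffS (F K : fieldType) (g : lieAlgType F) p (a : pform g K p.+1) X :
  ce_diff a X = \sum_(j < p.+2) \sum_(i < p.+1 | (i < j)%N) (-1) ^+ (i + j) *
    a (vcons (lie (X (lift j i)) (X j)) (fun k => X (lift j (lift i k)))).
Proof. by []. Qed.

(** When brackets are a-orthogonal to x1, y1, x2, y2, a term of d(a /\ a)
    survives only if its bracket is paired with z, and when moreover the planes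
    (x1, y1) and (x2, y2) are a-orthogonal, only if the other pair is one of
    these two planes. *)
Lemma ce_diff_wedge_sqr (K : numFieldType) (g : lieAlgType K)
    (a : g -> g -> K) (z x1 y1 x2 y2 : g) :
  (forall u v, a u v = - a v u) ->
  (forall u v t, t \in [:: x1; y1; x2; y2] -> a (lie u v) t = 0) ->
  a x1 x2 = 0 -> a x1 y2 = 0 -> a y1 x2 = 0 -> a y1 y2 = 0 ->
  ce_diff (wedge (form2 a) (form2 a)) (tnth [tuple z; x1; y1; x2; y2]) =
  - 2 * (a (lie x1 y1) z * a x2 y2 + a (lie x2 y2) z * a x1 y1).
Proof.
move=> skew a_lie a_x1x2 a_x1y2 a_y1x2 a_y1y2.
have a_lieE : ((forall u v, a (lie u v) x1 = 0) *
  (forall u v, a (lie u v) y1 = 0) * (forall u v, a (lie u v) x2 = 0) *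
  (forall u v, a (lie u v) y2 = 0))%type.
  by do !split => *; apply: a_lie; rewrite !inE eqxx ?orbT.
have ordE (F : 'I_4 -> g) : [/\ F 1 = F (lift ord0 ord0),
    F 2 = F (lift ord0 (lift ord0 ord0)) &
    F 3 = F (lift ord0 (lift ord0 (lift ord0 ord0)))].
  by split; congr F; apply/val_inj.
have ord1E F := let: And3 e _ _ := ordE F in e.
have ord2E F := let: And3 _ e _ := ordE F in e.
have ord3E F := let: And3 _ _ e := ordE F in e.
have XE (i : 'I_5) :
    tnth [tuple z; x1; y1; x2; y2] i = nth 0 [:: z; x1; y1; x2; y2] i.
  by rewrite (tnth_nth 0).
rewrite [LHS](@ce_diffS _ _ _ 3).
under eq_bigr do under eq_bigr do
  rewrite wedge_sqr // !ord1E !ord2E !ord3E !vconsS !vcons0 !XE.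
under eq_bigr do rewrite big_mkcond /=.
rewrite !big_ord_recl !big_ord0 /=.
rewrite /bump /= !(addn0, addnS, addn1, add0n) /=.
rewrite !a_lieE a_x1x2 a_x1y2 a_y1x2 a_y1y2.
by ring.
Qed.

(** * Linear isomorphisms and real coordinates *)

Lemma injective_linear_bijective (F : fieldType) (U V : vectType F)
    (f : {linear U -> V}) :
  \dim {:U} = \dim {:V} -> injective f -> bijective f.
Proof.
move=> dimUV f_inj.
have ker0 : lker (linfun f) == 0%VS.
  by apply/lker0P => u v; rewrite !lfunE; apply: f_inj.
have img : limg (linfun f) = fullv.
  by apply/eqP; rewrite eqEdim subvf limg_dim_eq ?dimUV //= (eqP ker0) capv0.
exists (linfun f)^-1%VF => [u|v].
  by rewrite -{2}[u](lker0_lfunK ker0) lfunE.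
have : v \in limg (linfun f) by rewrite img memvf.
by move/limg_lfunVK; rewrite lfunE.
Qed.

Lemma lie_isomorphic_of_ker0 (F : fieldType) (g h : lieAlgType F)
    (f : g -> h) :
  linear f -> (forall x, f x = 0 -> x = 0) -> \dim {:g} = \dim {:h} ->
  (forall x y, f (lie x y) = lie (f x) (f y)) -> lie_isomorphic g h.
Proof.
move=> f_lin f_ker dim_gh f_lie.
pose fL : {linear g -> h} :=
  HB.pack f (GRing.isLinear.Build F g h *:%R f f_lin).
exists fL; split=> //; apply: injective_linear_bijective => // x y fxy.
apply/eqP; rewrite -subr_eq0; apply/eqP/f_ker.
by rewrite -[f _]/(fL _) linearB fxy subrr.
Qed.

Section RealCoordinates.
Variable R : realType.

Definition real_coords (a b c : R[i]) : 'rV[R]_6 :=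
  \row_k [:: complex.Re a; complex.Im a; complex.Re b; complex.Im b;
             complex.Re c; complex.Im c]`_k.

Lemma real_coords_linear t a b c a' b' c' :
  real_coords (t%:C%C * a + a') (t%:C%C * b + b') (t%:C%C * c + c') =
  t *: real_coords a b c + real_coords a' b' c'.
Proof.
apply/rowP => k; rewrite !mxE.
case: a b c a' b' c' => [? ?] [? ?] [? ?] [? ?] [? ?] [? ?].
by case: k => -[|[|[|[|[|[|//]]]]]] /= _; ring.
Qed.

Lemma real_coords_inj a b c a' b' c' :
  real_coords a b c = real_coords a' b' c' -> [/\ a = a', b = b' & c = c'].
Proof.
move/rowP => E.
move: (E 0) (E 1) (E 2) (E 3) (E 4) (E 5); rewrite !mxE /=.
case: a b c a' b' c' {E} => [? ?] [? ?] [? ?] [? ?] [? ?] [? ?] /=.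
by move=> -> -> -> -> -> ->.
Qed.

Lemma real_coords_eq0 a b c :
  real_coords a b c = 0 -> [/\ a = 0, b = 0 & c = 0].
Proof.
move=> E; apply: real_coords_inj; rewrite E.
by apply/rowP => k; rewrite !mxE; case: k => -[|[|[|[|[|[|//]]]]]].
Qed.

End RealCoordinates.

(** * Hermitian metrics and frames of (1,0)-forms *)

Section Forms10.
Variables (R : realType) (g : lieAlgType R) (J : {linear g -> g}).

Lemma cdualP (w : cdual g) t X Y : w (t *: X + Y) = t%:C%C * w X + w Y.
Proof. by rewrite linearP. Qed.

Lemma cdualZ (w : cdual g) t X : w (t *: X) = t%:C%C * w X.
Proof. by rewrite linearZ. Qed.

Lemma form10J (w : cdual g) X : is_form10 J w -> w (J X) = - 'i%C * w X.
Proof. by move=> /(_ X); rewrite mulNr => <-; rewrite opprK. Qed.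

End Forms10.

Section Metric.
Variables (R : realType) (g : lieAlgType R) (J : {linear g -> g}).
Variable h : {dot g for idfun}.
Hypothesis JJ : forall X, J (J X) = - X.

Lemma metricC X Y : h X Y = h Y X.
Proof. by rewrite hermC expr0 mul1r. Qed.

Lemma metric_gt0 X : X != 0 -> 0 < h X X.
Proof. exact: neq0_dnorm_gt0. Qed.

Lemma metric_linear_l t X Y Z : h (t *: X + Y) Z = t * h X Z + h Y Z.
Proof. by rewrite linearDl linearZl_LR. Qed.

Lemma metricJJ X Y : h X (J (J Y)) = - h X Y.
Proof. by rewrite JJ linearNr. Qed.

(** A nonzero vector X is detected by the (1,0)-form
    Y |-> h(Y, X) + i h(JY, X), whose real part does not vanish at X; hence it
    is detected by every basis of the (1,0)-forms. *)
Lemma form10_separating n (w : 'I_n -> cdual g) X :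
  form10_basis J w -> (forall k, w k X = 0) -> X = 0.
Proof.
move=> [_ gen] wX0.
pose a (Y : g) : R[i] := (h Y X +i* h (J Y) X)%C.
have a_lin : linear_for (real_complex R \; *%R) a.
  move=> t Y Z; rewrite /a linearP !metric_linear_l /=.
  by simpc.
pose aL : cdual g := HB.pack a
  (GRing.isLinear.Build R g R[i] (real_complex R \; *%R) a a_lin).
have /gen[c [ac _]] : is_form10 J aL.
  move=> Y; rewrite /= /a JJ linearNl; simpc.
  by [].
apply/eqP; apply: contraT => /metric_gt0.
have: aL X = 0 by rewrite ac big1 // => k _; rewrite wX0 mulr0.
by rewrite /= /a => -[-> _]; rewrite ltxx.
Qed.

Hypothesis hJ : hermitian_metric J h.

Lemma metric_skewJ X Y : h X (J Y) = - h (J X) Y.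
Proof. by rewrite hJ JJ linearNr. Qed.

Lemma metricJ0 X : h X (J X) = 0.
Proof. have := metric_skewJ X X; rewrite [h (J X) X]metricC; lra. Qed.

(** The component of X orthogonal to the complex line spanned by E: by
    [metricJ0], E and JE are orthogonal, and they have the same norm. *)
Definition reject E X : g :=
  X - (h X E / h E E) *: E - (h X (J E) / h E E) *: J E.

Lemma rejectP E X : E != 0 -> h (reject E X) E = 0 /\ h (reject E X) (J E) = 0.
Proof.
move=> /metric_gt0 hE.
have hEJ := metricJ0 E.
have hJE : h (J E) E = 0 by rewrite metricC.
have hJJ : h (J E) (J E) = h E E by rewrite -hJ.
rewrite /reject !linearBl !linearZl_LR /= hEJ hJE hJJ.
by split; field; rewrite gt_eqF.
Qed.

Lemma reject_orth E X Y : h X Y = 0 -> h E Y = 0 -> h (J E) Y = 0 ->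
  h (reject E X) Y = 0.
Proof.
move=> XY EY JEY; rewrite /reject !linearBl !linearZl_LR /= XY EY JEY.
by rewrite !mulr0 !subr0.
Qed.

Lemma form10_reject (w : cdual g) E X : is_form10 J w -> w E = 0 ->
  w (reject E X) = w X.
Proof.
move=> wJ wE; rewrite /reject !linearB /= !cdualZ.
by rewrite (form10J _ wJ) wE !mulr0 !subr0.
Qed.

Section Frame.
Variables w1 w2 w3 : cdual g.
Hypothesis w_basis : form10_basis J (tnth [tuple w1; w2; w3]).

Lemma frame_form10 : [/\ is_form10 J w1, is_form10 J w2 & is_form10 J w3].
Proof.
case: w_basis => w10 _; split.
- exact: (w10 0).
- exact: (w10 1).
- exact: (w10 2).
Qed.

Lemma frame_separating X : w1 X = 0 -> w2 X = 0 -> w3 X = 0 -> X = 0.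
Proof.
move=> e1 e2 e3; apply: (form10_separating w_basis) => -[[|[|[|//]]] lt_k].
- by rewrite (tnth_nth w1).
- by rewrite (tnth_nth w1).
- by rewrite (tnth_nth w1).
Qed.

(** The three complex coordinates give an injective real-linear map from g to
    a real vector space of dimension six. *)
Lemma frame_surjective : \dim {:g} = 6%N ->
  forall a b c, exists X, [/\ w1 X = a, w2 X = b & w3 X = c].
Proof.
move=> dim_g a b c.
pose f X : 'rV[R]_6 := real_coords (w1 X) (w2 X) (w3 X).
have f_lin : linear f.
  by move=> t X Y; rewrite /f !cdualP real_coords_linear.
pose fL : {linear g -> 'rV[R]_6} :=
  HB.pack f (GRing.isLinear.Build R g 'rV[R]_6 *:%R f f_lin).
have fL_inj : injective fL.
  move=> X Y /real_coords_inj[e1 e2 e3]; apply/eqP; rewrite -subr_eq0.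
  by apply/eqP/frame_separating; rewrite linearB /= ?e1 ?e2 ?e3 subrr.
have dim6 : \dim {:g} = \dim {:'rV[R]_6} by rewrite dim_g dimvf /dim /= mul1n.
have [fV _ fVK] := injective_linear_bijective dim6 fL_inj.
exists (fV (real_coords a b c)).
by have /real_coords_inj[] := fVK (real_coords a b c).
Qed.

(** * The balanced condition *)

Variables (delta : R) (D : R[i]).
Hypothesis dw1 : forall X, ce_diff (form1 w1) X = 0.
Hypothesis dw2 : forall X, ce_diff (form1 w2) X = 0.
Hypothesis dw3 : forall X, ce_diff (form1 w3) X =
  wedge_bar w1 w1 X + delta%:C%C * wedge_bar w1 w2 X
  + D * wedge_bar w2 w2 X.

Lemma structure_equations X Y :
  [/\ w1 (lie X Y) = 0, w2 (lie X Y) = 0 &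
   w3 (lie X Y) = - ((w1 X * (w1 Y)^*%C - w1 Y * (w1 X)^*%C)
     + delta%:C%C * (w1 X * (w2 Y)^*%C - w1 Y * (w2 X)^*%C)
     + D * (w2 X * (w2 Y)^*%C - w2 Y * (w2 X)^*%C))].
Proof.
pose XY := tnth [tuple X; Y].
have E0 : XY ord0 = X by [].
have E1 : XY ord_max = Y by [].
move: (dw1 XY) (dw2 XY) (dw3 XY); rewrite !ce_diff1 /wedge_bar !wedge11 E0 E1.
move=> /eqP + /eqP + <-.
by rewrite opprK !oppr_eq0 => /eqP -> /eqP ->.
Qed.

(** Up to a positive factor, the Hermitian metric induced by h on the span of w1
    and w2 has the matrix with rows (1, conj(c)) and (c, |c|^2 + rho), and the
    displayed equation is the vanishing of the trace of d w3 against it. *)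
Lemma balanced_trace : \dim {:g} = 6%N -> balanced J h ->
  exists (c : R[i]) (rho : R), 0 < rho /\
    1 + delta%:C%C * c^*%C + D * (c * c^*%C + rho%:C%C) = 0.
Proof.
move=> dim_g bal.
have [w1J w2J w3J] := frame_form10.
have [E3 [E31 E32 E33]] := frame_surjective dim_g 0 0 1.
have [E2 [E21 E22 _]] := frame_surjective dim_g 0 1 0.
have [E1 [E11 E12 _]] := frame_surjective dim_g 1 0 0.
have nz (w : cdual g) X : w X = 1 -> X != 0.
  by move=> wX; apply: contra_eq_neq wX => ->; rewrite linear0 eq_sym oner_eq0.
have E3_neq0 := nz _ _ E33.
(* Complex Gram-Schmidt on E3, E2, E1. *)
pose B := reject E3 E2.
have [BE BJE] : h B E3 = 0 /\ h B (J E3) = 0 by apply: rejectP.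
have B1 : w1 B = 0 by rewrite form10_reject.
have B2 : w2 B = 1 by rewrite form10_reject.
have B_neq0 := nz _ _ B2.
pose A' := reject B E1.
pose A := reject E3 A'.
have A1 : w1 A = 1 by rewrite !form10_reject.
have A_neq0 := nz _ _ A1.
have [AE AJE] : h A E3 = 0 /\ h A (J E3) = 0 by apply: rejectP.
have [A'B A'JB] : h A' B = 0 /\ h A' (J B) = 0 by apply: rejectP.
have AB : h A B = 0.
  by apply: reject_orth; rewrite // metricC ?BE ?BJE.
have JE3B : h E3 (J B) = 0 by rewrite metric_skewJ // metricC BJE oppr0.
have AJB : h A (J B) = 0.
  by apply: reject_orth; rewrite // -?hJ // metricC.
have [hA hB] : 0 < h A A /\ 0 < h B B by split; apply: metric_gt0.
pose S := h B B *: lie A (J A) + h A A *: lie B (J B).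
have V3 Z : w1 Z = 0 -> w2 Z = 0 -> exists p q, Z = p *: E3 + q *: J E3.
  move=> Z1 Z2; exists (complex.Re (w3 Z)), (- complex.Im (w3 Z)).
  apply/eqP; rewrite -subr_eq0; apply/eqP; apply: frame_separating.
  - by rewrite linearB linearD /= !cdualZ form10J // E31 Z1 !mulr0 addr0 subr0.
  - by rewrite linearB linearD /= !cdualZ form10J // E32 Z2 !mulr0 addr0 subr0.
  rewrite linearB linearD /= !cdualZ form10J // E33.
  by case: (w3 Z) => u v; simpc => /=; simpc.
have orthV3 Z T : w1 Z = 0 -> w2 Z = 0 -> h T E3 = 0 -> h T (J E3) = 0 ->
    h Z T = 0 /\ h Z (J T) = 0.
  move=> Z1 Z2 TE TJE; have [p [q ->]] := V3 Z Z1 Z2.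
  rewrite !metric_linear_l !linearZl_LR /= -hJ // metric_skewJ.
  by rewrite !(metricC _ T) TE TJE oppr0 !mulr0 addr0.
have lieV3 U V : w1 (lie U V) = 0 /\ w2 (lie U V) = 0.
  by have [] := structure_equations U V.
pose F U V := h U (J V).
have F_skew U V : F U V = - F V U.
  by rewrite /F metric_skewJ // metricC.
have FA : F A (J A) = - h A A by rewrite /F metricJJ.
have FB : F B (J B) = - h B B by rewrite /F metricJJ.
have FJS U : F U (J S) = - h U S by rewrite /F metricJJ.
(* Testing against JS turns the balanced condition into h S S = 0. *)
have dFF0 : F (lie A (J A)) (J S) * F B (J B)
            + F (lie B (J B)) (J S) * F A (J A) = 0.
  have := bal (tnth [tuple J S; A; J A; B; J B]).
  have -> : fundamental_form J h = form2 F by [].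
  rewrite ce_diff_wedge_sqr //.
  - by move/eqP; rewrite mulf_eq0 oppr_eq0 pnatr_eq0 /= => /eqP.
  - move=> U V T; have [UV1 UV2] := lieV3 U V.
    have [LA LJA] := orthV3 _ _ UV1 UV2 AE AJE.
    have [LB LJB] := orthV3 _ _ UV1 UV2 BE BJE.
    rewrite !inE /F => /or4P[] /eqP -> //.
    + by rewrite metricJJ LA oppr0.
    + by rewrite metricJJ LB oppr0.
  - by rewrite /F metricJJ AB oppr0.
  - by rewrite /F -hJ.
  - by rewrite /F -hJ.
have S0 : S = 0.
  apply/eqP; apply: contraT => /metric_gt0.
  suff -> : h S S = 0 by rewrite ltxx.
  rewrite {1}/S metric_linear_l linearZl_LR /= -[RHS]dFF0 !FJS FA FB.
  by ring.
have lieJ U : w3 (lie U (J U)) = - (2 * 'i%C * (w1 U * (w1 U)^*%C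
    + delta%:C%C * (w1 U * (w2 U)^*%C) + D * (w2 U * (w2 U)^*%C))).
  have [_ _ ->] := structure_equations U (J U).
  rewrite !form10J //.
  have conj_Ni z : (- 'i%C * z)^*%C = 'i%C * z^*%C :> R[i].
    case: z => u v; apply/eqP; rewrite eq_complex /=.
    by apply/andP; split; apply/eqP; ring.
  by rewrite !conj_Ni; ring.
exists (w2 A), (h A A / h B B); split; first by rewrite divr_gt0.
have : w3 S = 0 by rewrite S0 linear0.
rewrite /S linearD /= !cdualZ !lieJ A1 B1 B2.
rewrite conjc1 conjc0 fmorph_div /= => wS.
have i_neq0 : 2 * 'i%C != 0 :> R[i].
  by rewrite mulf_neq0 ?pnatr_eq0 // eq_complex /= oner_eq0 andbF.
have hB_neq0 : (h B B)%:C%C != 0 :> R[i] by rewrite fmorph_eq0 gt_eqF.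
apply: (mulfI (mulf_neq0 i_neq0 hB_neq0)); rewrite mulr0.
rewrite -[RHS]oppr0 -[in RHS]wS.
by field.
Qed.

End Frame.
End Metric.

Lemma trace_condition0 (R : realType) (rho : R) (c D : R[i]) : 0 < rho ->
  1 + 0%:C%C * c^*%C + D * (c * c^*%C + rho%:C%C) = 0 ->
  complex.Im D = 0 /\ complex.Re D != 0.
Proof.
case: c D => p q [x y] rho_gt0 /eqP.
rewrite eq_complex /= => /andP[/eqP eR /eqP eI].
have b_gt0 : 0 < p ^+ 2 + q ^+ 2 + rho by nra.
have {}eR : 1 + x * (p ^+ 2 + q ^+ 2 + rho) = 0 by rewrite -[RHS]eR; ring.
have {}eI : y * (p ^+ 2 + q ^+ 2 + rho) = 0 by rewrite -[RHS]eI; ring.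
split.
  by move/eqP: eI; rewrite mulf_eq0 (gt_eqF b_gt0) orbF => /eqP.
by apply: contra_eq_neq eR => ->; rewrite mul0r addr0 oner_eq0.
Qed.

(** With D = x + iy and b = |c|^2 + rho, the hypothesis gives
    |1 + D b|^2 = |c|^2 < b: a real quadratic polynomial in b, with positive
    leading coefficient unless D = 0, takes a negative value; the conclusion is
    the positivity of its discriminant. *)
Lemma trace_condition1 (R : realType) (rho : R) (c D : R[i]) : 0 < rho ->
  1 + 1%:C%C * c^*%C + D * (c * c^*%C + rho%:C%C) = 0 ->
  0 < 1 - 4 * complex.Re D - 4 * complex.Im D ^+ 2.
Proof.
case: c D => p q [x y] rho_gt0 /eqP.
rewrite eq_complex /= => /andP[/eqP eR /eqP eI].
set b := p ^+ 2 + q ^+ 2 + rho.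
have b_gt0 : 0 < b by rewrite /b; nra.
have pE : p = - 1 - x * b.
  by apply/eqP; rewrite -subr_eq0 -[X in _ == X]eR /b; apply/eqP; ring.
have qE : q = y * b.
  by apply/eqP; rewrite eq_sym -subr_eq0 -[X in _ == X]eI /b; apply/eqP; ring.
have key : p ^+ 2 + q ^+ 2 < b by rewrite /b; lra.
clearbody b; rewrite pE qE in key.
rewrite -(pmulr_rgt0 _ (exprn_gt0 2 b_gt0)).
suff -> : b ^+ 2 * (1 - 4 * x - 4 * y ^+ 2) = (2 + 2 * x * b - b) ^+ 2
    + 4 * (b - ((- 1 - x * b) ^+ 2 + (y * b) ^+ 2)).
  by rewrite ltr_wpDl ?sqr_ge0 // mulr_gt0 // subr_gt0.
by ring.
Qed.

(** * Coframes of h3 and h5 *)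

(** For delta = 1, the form p d(w3) + q d(conj w3) has coefficient matrix with rows
    (p - q, p) and (- q, p D - q conj(D)) in the products w_j /\ conj(w_k).
    For p = m and q = - 2 D its determinant is
    D (|m + 2D|^2 - 2m), so the first identity says that m gives a
    decomposable member of the pencil.  The second one gives m > 2 |D| when s and m
    are positive, which makes the two factors and their conjugates
    independent. *)
Lemma pencil_root (R : realType) (s m : R) (D : R[i]) :
  s ^+ 2 = 1 - 4 * complex.Re D - 4 * complex.Im D ^+ 2 ->
  m = 1 - 2 * complex.Re D + s ->
  (m%:C%C + 2 * D) * (m%:C%C + 2 * D^*%C) = 2 * m%:C%C /\
  m%:C%C ^+ 2 - 4 * (D * D^*%C) = (2 * (s * m))%:C%C.
Proof.
case: D => u v /= s2 ->.
split; apply/eqP; rewrite eq_complex /=; apply/andP; split; apply/eqP;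
  try by ring.
- transitivity (2 * (1 - 2 * u + s) + (s ^+ 2 - (1 - 4 * u - 4 * v ^+ 2))).
    by ring.
  by rewrite s2; ring.
- transitivity (2 * (s * (1 - 2 * u + s))
                - (s ^+ 2 - (1 - 4 * u - 4 * v ^+ 2))).
    by ring.
  by rewrite s2; ring.
Qed.

Section Isomorphisms.
Variables (R : realType) (g : lieAlgType R) (w1 w2 w3 : cdual g).
Hypothesis dim_g : \dim {:g} = 6%N.
Hypothesis w_sep : forall X, w1 X = 0 -> w2 X = 0 -> w3 X = 0 -> X = 0.
Hypothesis w1_lie : forall X Y, w1 (lie X Y) = 0.
Hypothesis w2_lie : forall X Y, w2 (lie X Y) = 0.

(** Since w /\ conj(w) = - 2i Re(w) /\ Im(w), the form - Im(w3) / 2 has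
    differential Re(w1) /\ Im(w1) + x Re(w2) /\ Im(w2), and Re(w3) is closed;
    the factor x is absorbed in Re(w2). *)
Lemma lie_isomorphic_h3 (x : R) : x != 0 ->
  (forall X Y, w3 (lie X Y) = - ((w1 X * (w1 Y)^*%C - w1 Y * (w1 X)^*%C)
     + x%:C%C * (w2 X * (w2 Y)^*%C - w2 Y * (w2 X)^*%C))) ->
  lie_isomorphic g (h3 R).
Proof.
move=> x_neq0 w3_lie.
pose f X : h3 R := real_coords (w1 X)
  (x * complex.Re (w2 X) +i* complex.Im (w2 X))%C
  (complex.Re (w3 X) +i* - (complex.Im (w3 X) / 2))%C.
apply: (@lie_isomorphic_of_ker0 _ _ _ f).
- move=> t X Y; rewrite /f !cdualP -real_coords_linear; congr real_coords;
    case: (w2 X) (w2 Y) (w3 X) (w3 Y) => [? ?] [? ?] [? ?] [? ?];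
    by apply/eqP; rewrite eq_complex /=; apply/andP; split; apply/eqP; field.
- move=> X /real_coords_eq0[w1X].
  case w2X: (w2 X) => [u v] [/= /eqP].
  rewrite mulf_eq0 (negPf x_neq0) => /= /eqP u0 v0.
  case w3X: (w3 X) => [s t] [/= s0 /eqP].
  rewrite oppr_eq0 mulf_eq0 invr_eq0 pnatr_eq0 orbF => /eqP t0.
  by apply: w_sep; rewrite // ?w2X ?w3X ?u0 ?v0 ?s0 ?t0.
- by rewrite dim_g dimvf /dim /= mul1n.
move=> X Y; apply/rowP => k; rewrite !mxE /coord2 !mxE w1_lie w2_lie w3_lie.
case: (w1 X) (w1 Y) (w2 X) (w2 Y) => [? ?] [? ?] [? ?] [? ?].
by case: k => -[|[|[|[|[|[|//]]]]]] ? /=; field.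
Qed.

(** The coframe (eta1, eta2, eta3) below satisfies d eta3 = eta1 /\ eta2, and
    the real and imaginary parts of this equation are those defining h5.  The
    form eta3 is m times the member of the pencil given by [pencil_root]; the
    factor m keeps the coefficients of eta1 free of denominators. *)
Lemma lie_isomorphic_h5 (D : R[i]) :
  0 < 1 - 4 * complex.Re D - 4 * complex.Im D ^+ 2 ->
  (forall X Y, w3 (lie X Y) = - ((w1 X * (w1 Y)^*%C - w1 Y * (w1 X)^*%C)
     + (w1 X * (w2 Y)^*%C - w1 Y * (w2 X)^*%C)
     + D * (w2 X * (w2 Y)^*%C - w2 Y * (w2 X)^*%C))) ->
  lie_isomorphic g (h5 R).
Proof.
move=> disc_gt0 w3_lie.
pose s := Num.sqrt (1 - 4 * complex.Re D - 4 * complex.Im D ^+ 2).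
have s_gt0 : 0 < s by rewrite sqrtr_gt0.
have s2 : s ^+ 2 = 1 - 4 * complex.Re D - 4 * complex.Im D ^+ 2.
  by rewrite sqr_sqrtr // ltW.
pose m := 1 - 2 * complex.Re D + s.
have m_gt0 : 0 < m by rewrite /m; nra.
pose M := m%:C%C.
have conjM : M^*%C = M by rewrite conjc_real.
have M_neq0 : M != 0 by rewrite fmorph_eq0 gt_eqF.
have [rel disc] := pencil_root s2 (erefl m).
have disc_neq0 : M ^+ 2 - 4 * (D * D^*%C) != 0.
  by rewrite disc fmorph_eq0 gt_eqF // !mulr_gt0.
have conj2 : (2 : R[i])^*%C = 2 by rewrite conjc_nat.
have conj_mul (a b : R[i]) : (a * b)^*%C = a^*%C * b^*%C by exact: rmorphM.
have conj_add (a b : R[i]) : (a + b)^*%C = a^*%C + b^*%C by exact: rmorphD.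
have conj_opp (a : R[i]) : (- a)^*%C = - a^*%C by exact: rmorphN.
pose conjE := (conj_mul, conj_add, conj_opp, @conjcK R).
pose eta1 X := M * w1 X + D * (M + 2 * D^*%C) * w2 X.
pose eta2 X := (M + 2 * D) * (w1 X)^*%C + M * (w2 X)^*%C.
pose eta3 X := M * (M * w3 X - 2 * D * (w3 X)^*%C).
pose f X : h5 R := real_coords (eta1 X) (eta2 X) (eta3 X).
have eta3_lie X Y : eta3 (lie X Y) = - (eta1 X * eta2 Y - eta1 Y * eta2 X).
  rewrite /eta3 w3_lie !conjE.
  apply/eqP; rewrite -subr_eq0; apply/eqP.
  transitivity (D * (w2 X * (w1 Y)^*%C - w2 Y * (w1 X)^*%C) *
    ((M + 2 * D) * (M + 2 * D^*%C) - 2 * M)).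
    by rewrite /eta1 /eta2; ring.
  by rewrite rel subrr mulr0.
apply: (@lie_isomorphic_of_ker0 _ _ _ f).
- move=> t X Y; rewrite /f -real_coords_linear /eta1 /eta2 /eta3 !cdualP.
  rewrite !(conjE, conjc_real).
  by congr real_coords; ring.
- move=> X /real_coords_eq0[/eqP e1 /eqP e2 /eqP e3].
  have {}e1 : M * w1 X = - (D * (M + 2 * D^*%C) * w2 X).
    by apply/eqP; rewrite -addr_eq0.
  have {}e2 : M * (w2 X)^*%C = - ((M + 2 * D) * (w1 X)^*%C).
    by apply/eqP; rewrite -addr_eq0 addrC.
  have {}e3 : M * w3 X = 2 * D * (w3 X)^*%C.
    by apply/eqP; move: e3; rewrite mulf_eq0 (negPf M_neq0) subr_eq0.
  have norm0 (z : R[i]) :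
      M ^+ 2 * (z * z^*%C) = 4 * (D * D^*%C) * (z * z^*%C) -> z = 0.
    move/eqP; rewrite -subr_eq0 -mulrBl !mulf_eq0 (negPf disc_neq0) conjc_eq0.
    by rewrite orbb => /eqP.
  have := congr1 conjc e1; have := congr1 conjc e2; have := congr1 conjc e3.
  rewrite !(conjE, conjM, conj2) => c3 c2 c1.
  (* Squared norms: m |w2|^2 = 2 |w1|^2 and m |w1|^2 = 2 |D|^2 |w2|^2. *)
  have n2 : M * (w2 X * (w2 X)^*%C) = 2 * (w1 X * (w1 X)^*%C).
    apply: (mulfI M_neq0).
    transitivity ((M * w2 X) * (M * (w2 X)^*%C)); first by ring.
    rewrite e2 c2 mulrNN.
    transitivity (w1 X * (w1 X)^*%C * ((M + 2 * D) * (M + 2 * D^*%C))).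
      by ring.
    by rewrite rel; ring.
  have w2X0 : w2 X = 0.
    apply: norm0; apply: (mulfI M_neq0).
    transitivity (M ^+ 2 * (M * (w2 X * (w2 X)^*%C))); first by ring.
    rewrite n2.
    transitivity (2 * ((M * w1 X) * (M * (w1 X)^*%C))); first by ring.
    rewrite e1 c1 mulrNN.
    transitivity (2 * (D * D^*%C) * (w2 X * (w2 X)^*%C) *
                  ((M + 2 * D) * (M + 2 * D^*%C))); first by ring.
    by rewrite rel; ring.
  have w1X0 : w1 X = 0.
    apply/eqP; move/eqP: e1.
    by rewrite w2X0 mulr0 oppr0 mulf_eq0 (negPf M_neq0).
  apply: w_sep => //; apply: norm0.
  transitivity ((M * w3 X) * (M * (w3 X)^*%C)); first by ring.
  by rewrite e3 c3; ring.
- by rewrite dim_g dimvf /dim /= mul1n.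
move=> X Y; apply/rowP => k; rewrite !mxE /coord2 !mxE eta3_lie.
have -> : eta1 (lie X Y) = 0 by rewrite /eta1 w1_lie w2_lie !mulr0 addr0.
have -> : eta2 (lie X Y) = 0.
  by rewrite /eta2 w1_lie w2_lie conjc0 !mulr0 addr0.
case: (eta1 X) (eta1 Y) (eta2 X) (eta2 Y) => [? ?] [? ?] [? ?] [? ?].
by case: k => -[|[|[|[|[|[|//]]]]]] ? /=; ring.
Qed.

End Isomorphisms.

Theorem proposition2p8 (R : realType) (g : lieAlgType R)
    (dim_g : \dim {:g} = 6%N) (nil_g : step_nilpotent g 2)
    (J : {linear g -> g}) (abelJ : abelian_complex_structure J)
    (delta x y : R) (delta01 : delta = 0 \/ delta = 1)
    (w1 w2 w3 : cdual g) (w_basis : form10_basis J (tnth [tuple w1; w2; w3]))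
    (dw1 : forall X, ce_diff (form1 w1) X = 0)
    (dw2 : forall X, ce_diff (form1 w2) X = 0)
    (dw3 : forall X, ce_diff (form1 w3) X =
       wedge_bar w1 w1 X + delta%:C%C * wedge_bar w1 w2 X
       + (x +i* y)%C * wedge_bar w2 w2 X)
    (balJ : exists h : {dot g for idfun}, hermitian_metric J h /\ balanced J h) :
  (delta = 0 -> lie_isomorphic g (h3 R)) /\
  (delta = 1 -> lie_isomorphic g (h5 R)).
Proof.
case: balJ => h [hJ bal]; have [[JJ _] _] := abelJ.
have [c [rho [rho_gt0 tr]]] :=
  balanced_trace JJ hJ w_basis dw1 dw2 dw3 dim_g bal.
have w_sep := frame_separating h JJ w_basis.
have w_lie := structure_equations dw1 dw2 dw3.
have w1_lie X Y : w1 (lie X Y) = 0 by have [] := w_lie X Y.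
have w2_lie X Y : w2 (lie X Y) = 0 by have [] := w_lie X Y.
split=> d; rewrite {}d in tr w_lie.
  have [/= y0 x_neq0] := trace_condition0 rho_gt0 tr.
  apply: (lie_isomorphic_h3 dim_g w_sep w1_lie w2_lie x_neq0) => X Y.
  have [_ _ ->] := w_lie X Y.
  by rewrite mul0r addr0 y0.
apply: (lie_isomorphic_h5 dim_g w_sep w1_lie w2_lie
          (trace_condition1 rho_gt0 tr)) => X Y.
by have [_ _ ->] := w_lie X Y; rewrite mul1r.
Qed.
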